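(* Let $(a_0,b_0)=(0,0)$ and, for $n\ge 1$, let $a_n=\lfloor \phi (n-1)\rfloor+1$ and $b_n=\lfloor \phi^2 (n-1)\rfloor+1$, so that $\{(a_i,b_i)\mid i\ge 0\}$ is the set of $\mathcal{P}$-positions of $\mathcal{F}$-Wythoff. Then for each $n\ge 1$, $$a_n = \mathrm{mex}\{a_i,b_i \mid 0\le i\le n-1\},\qquad b_n=a_n+n-1.$$
   Context: $\phi = (1+\sqrt5)/2$ and $\lfloor\cdot\rfloor$ is the integer part. For a finite set $S$ of nonnegative integers, $\mathrm{mex}(S)$ is the smallest nonnegative integer not in $S$. A position is an unordered pair $(a,b)$ of nonnegative integers (two piles of tokens); $(a,b)$ is identified with $(b,a)$. $\mathcal{F}$-Wythoff is the impartial two-player game with the following legal moves: (i) remove any positive number of tokens from one pile; (ii) remove the same positive number $k$ of tokens from both piles, provided the integer ratio of the two entries does not change, i.e. from $(a,b)$ with $1\le a\le b$ one may move to $(a-k,b-k)$ with $1\le k<a$ if $\lfloor (b-k)/(a-k)\rfloor=\lfloor b/a\rfloor$. Players alternate moves; the player first unable to move loses. A $\mathcal{P}$-position is a position from which the player about to move has no winning strategy. *)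

(* Defs.v *)
From HB Require Import structures.
From mathcomp Require Import all_boot all_order all_algebra finmap.
From mathcomp Require Import all_classical all_reals.

Set Implicit Arguments.
Unset Strict Implicit.
Unset Printing Implicit Defensive.

Import Order.TTheory GRing.Theory Num.Theory.

(* An unordered pair is represented by its nondecreasing ordering. *)
Definition position := {p : nat * nat | p.1 <= p.2}.

Fact pos_subproof (a b : nat) : (minn a b, maxn a b).1 <= (minn a b, maxn a b).2.
Proof. exact: leq_trans (geq_minl a b) (leq_maxl a b). Qed.

Definition pos (a b : nat) : position :=
  exist (fun p : nat * nat => p.1 <= p.2) (minn a b, maxn a b) (pos_subproof a b).

Fact posC (a b : nat) : pos a b = pos b a.
Proof. by apply/val_inj; rewrite /= minnC maxnC. Qed.

(* By posC, [move_one] covers taking tokens from either pile. *)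
Inductive move : position -> position -> Prop :=
| move_one (a b k : nat) :
    1 <= k <= a -> move (pos a b) (pos (a - k) b)
| move_both (a b k : nat) :
    1 <= a <= b -> 1 <= k < a -> (b - k) %/ (a - k) = b %/ a ->
    move (pos a b) (pos (a - k) (b - k)).

(* [winning_from sigma p]: the player about to move at [p] who always plays
   [sigma] has a legal move whenever it is his turn, and, [winning_from] being
   inductive, the opponent gets stuck after finitely many moves whatever he
   plays. Since a position records everything relevant to the continuation of
   the game, strategies are taken to depend on the current position only. *)
Inductive winning_from (sigma : position -> position) (p : position) : Prop :=
| WinningFrom of move p (sigma p)
    & (forall q : position, move (sigma p) q -> winning_from sigma q).

Definition P_position (p : position) : Prop :=
  ~ exists sigma : position -> position, winning_from sigma p.

Fact mex_exists (S : {fset nat}) : exists n, n \notin S.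
Proof.
exists (\max_(i <- enum_fset S) i).+1; apply/negP => h.
by have := @leq_bigmax_seq _ (enum_fset S) xpredT id _ h erefl; rewrite ltnn.
Qed.

Definition mex (S : {fset nat}) : nat := ex_minn (mex_exists S).

Local Open Scope ring_scope.

Definition phi (R : realType) : R := (1 + Num.sqrt 5) / 2.

(* [Num.truncn] agrees with the integer part on nonnegative reals. *)
Definition a_ (R : realType) (n : nat) : nat :=
  if n is m.+1 then (Num.truncn (phi R * m%:R) + 1)%N else 0%N.

Definition b_ (R : realType) (n : nat) : nat :=
  if n is m.+1 then (Num.truncn (phi R ^+ 2 * m%:R) + 1)%N else 0%N.

(* Main.v *)
(* For [n >= 2] the values [a_n] and [b_n] are a shifted pair of complementary
   Beatty sequences, and [a_1 = b_1 = 1]; hence every positive integer occurs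
   among the [a_n], [b_n], with [a_i = b_j] only when [i = j], which yields the
   mex recurrence. The differences [b_n - a_n = n - 1] are distinct for [n >= 1],
   so no move joins two pairs. From any other position [(x, y)] one reaches a
   pair by lowering one pile, except when [x = a_n <= y < b_n]; then the pair of
   difference [y - x] is reached by a diagonal move, which is legal because
   [b_n < 2 a_n] forces both integer ratios to be 1. *)

Require Import Defs.
From mathcomp Require Import all_boot all_order all_algebra finmap.
From mathcomp Require Import all_classical all_reals.
From mathcomp Require Import ring lra zify.

Set Implicit Arguments.
Unset Strict Implicit.
Unset Printing Implicit Defensive.

Import Order.TTheory GRing.Theory Num.Theory.

(** * P-positions as the kernel of the move relation *)

Lemma move_decreasing (p q : position) :
  move p q -> (val q).1 + (val q).2 < (val p).1 + (val p).2.
Proof. by case=> a b k /=; lia. Qed.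

(** Outside [K], choice yields a strategy that always moves into [K]; it wins because the token
    total decreases. Inside [K], any winning strategy would have to leave [K] and the opponent can
    always return, which contradicts the well-foundedness of [winning_from]. *)
Lemma P_position_kernel (K : position -> Prop) :
    (forall p q, K p -> move p q -> ~ K q) ->
    (forall p, ~ K p -> exists2 q, move p q & K q) ->
  forall p, P_position p <-> K p.
Proof.
move=> indep absorb p.
have /choice[sigma sigmaP] x : exists y, ~ K x -> move x y /\ K y.
  by have [Kx|/absorb[y xy Ky]] := EM (K x); [exists x | exists y].
split=> [Pp|Kp [tau win_p]].
  apply: contrapT => nKp; apply: Pp; exists sigma.
  have [n] := ubnP ((val p).1 + (val p).2).
  elim: n p nKp => [p _|n IHn p nKp ltpn]; first by rewrite ltn0.
  have [mp Ksp] := sigmaP p nKp.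
  split=> [|q mq]; first exact: mp.
  apply: IHn; first exact: indep mq.
  by have := move_decreasing mp; have := move_decreasing mq; lia.
elim: win_p Kp => {}p mp _ IH Kp.
have [q mq Kq] := absorb _ (indep _ _ Kp mp).
exact: IH mq Kq.
Qed.

Lemma posE (p : position) : p = pos (val p).1 (val p).2.
Proof.
by apply: val_inj; case: p => -[x y] xy /=; rewrite (minn_idPl xy) (maxn_idPr xy).
Qed.

Lemma divn_eq1 (x y : nat) : x <= y < 2 * x -> y %/ x = 1.
Proof.
move=> /andP[xy yx]; have x_gt0 : 0 < x by lia.
by rewrite -(subnKC xy) divnDl// divnn x_gt0 divn_small//; lia.
Qed.

(** * Arithmetic of the golden ratio *)

Section GoldenRatio.
Local Open Scope ring_scope.
Variable R : realType.
Local Notation phi := (phi R).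

Lemma phi_sqr : phi ^+ 2 = phi + 1.
Proof.
have s5 : Num.sqrt 5 ^+ 2 = 5 :> R by rewrite sqr_sqrtr.
rewrite /Defs.phi; nra.
Qed.

(** Keeps bounds linear after they are multiplied by [phi]. *)
Lemma phi_mulA (x : R) : phi * (phi * x) = phi * x + x.
Proof. by rewrite mulrA -expr2 phi_sqr mulrDl mul1r. Qed.

Lemma phi_gt1 : 1 < phi.
Proof.
have s5 : Num.sqrt 5 ^+ 2 = 5 :> R by rewrite sqr_sqrtr.
have s0 : 0 <= Num.sqrt 5 :> R by exact: sqrtr_ge0.
rewrite /Defs.phi; nra.
Qed.

Lemma phi_lt2 : phi < 2.
Proof. by have := phi_sqr; have := phi_gt1; nra. Qed.

Lemma phi_irrational (m t : nat) : phi * m%:R = t%:R -> m = 0%N.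
Proof.
move=> mt; apply/eqP; rewrite -leqn0 leqNgt; apply/negP => m_gt0.
have tm : (t ^ 2 = t * m + m ^ 2)%N.
  apply/eqP; rewrite -(eqr_nat R) natrD natrM !natrX -mt.
  by rewrite exprMn phi_sqr; apply/eqP; ring.
(* The 5-adic valuation is even on the left, odd on the right. *)
have : ((2 * t - m) ^ 2 = 5 * m ^ 2)%N by nia.
move=> /(congr1 (logn 5)).
rewrite lognM ?expn_gt0 ?m_gt0// !lognX (@logn_prime 5 5)//.
lia.
Qed.

(** * The shifted Beatty sequences and the mex recurrence *)

Lemma a_S (m t : nat) : t%:R <= phi * m%:R < t%:R + 1 -> a_ R m.+1 = t.+1.
Proof. by move=> mt; rewrite /a_ (truncn_def (n := t)) ?addn1// -natr1. Qed.

Lemma a_bounds (m : nat) :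
  (a_ R m.+1)%:R - 1 <= phi * m%:R < (a_ R m.+1)%:R.
Proof.
have := phi_gt1 => ?.
have /truncn_itv : 0 <= phi * m%:R by rewrite mulr_ge0// ltW//; lra.
by rewrite /a_ addn1 -!natr1 addrK.
Qed.

(** Since [phi ^+ 2 = phi + 1], the two arguments of [truncn] differ by the integer [m]. *)
Lemma b_S (m : nat) : b_ R m.+1 = (a_ R m.+1 + m)%N.
Proof.
rewrite /b_ (truncn_def (n := (a_ R m.+1 + m).-1)).
  by rewrite addn1 prednK// /a_ addn1.
have := a_bounds m; have : (0 < a_ R m.+1)%N by rewrite /a_ addn1.
case: (a_ _ _) => // t _; rewrite addSn /= phi_sqr -!natr1 natrD.
lra.
Qed.

Lemma b_addE (n : nat) : b_ R n = (a_ R n + n.-1)%N.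
Proof. by case: n => // n; exact: b_S. Qed.

Lemma a_ltS (n : nat) : (a_ R n < a_ R n.+1)%N.
Proof.
case: n => [|n]; first by rewrite /a_ addn1.
have := a_bounds n; have := a_bounds n.+1; have := phi_gt1.
rewrite -(ltr_nat R) -natr1; lra.
Qed.

Lemma a_le : {mono a_ R : m n / (m <= n)%N}.
Proof. exact/leq_mono/(homo_ltn ltn_trans)/a_ltS. Qed.

Lemma a_lt : {mono a_ R : m n / (m < n)%N}.
Proof. exact: leqW_mono a_le. Qed.

Lemma b_le : {mono b_ R : m n / (m <= n)%N}.
Proof.
apply/leq_mono/(homo_ltn ltn_trans) => -[|n]; first by rewrite b_S /a_ addn1.
by rewrite !b_S addnS ltnS leq_add2r ltnW// a_ltS.
Qed.

Lemma a_le_b (n : nat) : (a_ R n <= b_ R n)%N.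
Proof. by rewrite b_addE leq_addr. Qed.

Lemma b_lt_double_a (n : nat) : (0 < n)%N -> (b_ R n < 2 * a_ R n)%N.
Proof.
case: n => // n _; rewrite b_S.
suff : (n < a_ R n.+1)%N by lia.
by elim: n => [|n IHn]; [rewrite /a_ addn1 | exact: leq_ltn_trans IHn (a_ltS _)].
Qed.

(** The disjointness half of Beatty's theorem. The conclusion is not absurdity because the pairs of
    index 0 and 1 have equal entries. *)
Lemma a_eq_b (i j : nat) : a_ R i = b_ R j -> i = j.
Proof.
case: i j => [|m] [|k] //.
- by have := a_ltS k; rewrite b_S /=; lia.
- by have := a_ltS m; rewrite /=; lia.
rewrite b_S => e; have := a_bounds m; have := a_bounds k.
rewrite {}e; case: (a_ R k.+1) (a_ltS k) => // t _.
rewrite addSn -!natr1 natrD => kt mt.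
have [[phi1 phi2] phiE] := (phi_gt1, phi_lt2, phi_mulA).
have {phiE} [phik phim] := (phiE k%:R, phiE m%:R).
(* If [a_ m.+1 = b_ k.+1 = t.+1 + k], then dividing the bounds on [phi * m] and
   [phi * k] by [phi] shows [t <= m < t + 1]; here [(phi - 1)] is [phi^-1] and
   [(2 - phi)] is [phi^-2]. *)
have mt1 : m%:R < t.+1%:R :> R.
  rewrite -natr1.
  have : 0 < (phi - 1) * (t%:R + 1 + k%:R - phi * m%:R) by apply: mulr_gt0; lra.
  have : 0 < (2 - phi) * (t%:R + 1 - phi * k%:R) by apply: mulr_gt0; lra.
  lra.
have tm1 : t%:R <= m%:R :> R.
  have : 0 <= (phi - 1) * (phi * m%:R - (t%:R + k%:R)) by apply: mulr_ge0; lra.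
  have : 0 <= (2 - phi) * (phi * k%:R - t%:R) by apply: mulr_ge0; lra.
  lra.
move: mt1 tm1; rewrite ltr_nat ler_nat => mt1 tm1.
have {mt1 tm1}mE : m = t by lia.
subst m.
(* With [m = t], the lower bound on [phi * m] times [phi] gives [phi * k <= t]; irrationality then
   leaves only [k = t = 0]. *)
have e : phi * k%:R = t%:R.
  have : 0 <= phi * (phi * t%:R - (t%:R + k%:R)) by apply: mulr_ge0; lra.
  by move=> ?; apply/eqP; rewrite eq_le; apply/andP; split; lra.
have k0 := phi_irrational e; subst k; move: e; rewrite mulr0 => /esym/eqP.
by rewrite pnatr_eq0 => /eqP->.
Qed.

Lemma a_b_cover (N : nat) : (0 < N)%N ->
  exists2 n, (0 < n)%N & a_ R n = N \/ b_ R n = N.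
Proof.
case: N => // N _.
have [[phi1 phi2] phiE] := (phi_gt1, phi_lt2, phi_mulA).
(* As [phi - 1] is [phi^-1], this [m] is the largest integer with [phi * m <= N + 1], hence the only
   candidate for [a_ m.+1 = N.+1]. *)
have /truncn_itv : 0 <= (phi - 1) * N.+1%:R :> R by rewrite mulr_ge0//; lra.
set m := Num.truncn _; rewrite -!natr1 => mN.
have [[phim phiN] phi_1] := (phiE m%:R, phiE N%:R, phiE 1).
have [mltN|Nm] := ltP (phi * m%:R) N%:R.
  have mN1 : (m <= N)%N.
    rewrite -(ler_nat R).
    have : 0 <= (phi - 1) * m%:R by apply: mulr_ge0; rewrite ?ler0n//; lra.
    lra.
  (* Here [phi * m < N] and [N + 1 < phi * (m + 1)]; multiplied by [phi] and by [phi - 1]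
     respectively, they put [phi * (N - m)] in [[m, m + 1)]. *)
  exists (N - m).+1 => //; right.
  rewrite b_S (@a_S _ m) ?addSn ?subnKC// natrB//.
  have : 0 < phi * (N%:R - phi * m%:R) by apply: mulr_gt0; lra.
  have : 0 < phi * (m%:R + 1 - (phi - 1) * (N%:R + 1)) by apply: mulr_gt0; lra.
  lra.
exists m.+1 => //; left; apply: a_S; rewrite Nm/=.
have : 0 <= phi * ((phi - 1) * (N%:R + 1) - m%:R) by apply: mulr_ge0; lra.
rewrite lt_neqAle => ?; apply/andP; split; last by lra.
(* Equality [phi * m = N + 1] would force [m = 0] by irrationality, hence [N + 1 = 0]. *)
apply/eqP; rewrite natr1 => e.
have m0 := phi_irrational e.
by move/eqP: e; rewrite m0 mulr0 eq_sym pnatr_eq0.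
Qed.

(** Monotonicity and [a_eq_b] make [a_ n] new. A positive [v < a_ n] occurs by [a_b_cover] at some
    [i] with [a_ i <= v], so [i < n]. *)
Lemma a_mex (n : nat) : (0 < n)%N ->
  a_ R n = mex ([fset a_ R i | i in iota 0 n] `|` [fset b_ R i | i in iota 0 n])%fset.
Proof.
move=> n_gt0; rewrite /mex; set S := (_ `|` _)%fset.
have inS v : reflect (exists2 i, (i < n)%N & v = a_ R i \/ v = b_ R i) (v \in S).
  apply: (iffP (fsetUP _ _ _)) => [[]/imfsetP[i /=]|[i ltin [->|->]]].
  - by rewrite mem_iota => /andP[_ ?] ->; exists i => //; left.
  - by rewrite mem_iota => /andP[_ ?] ->; exists i => //; right.
  - by left; apply/imfsetP; exists i; rewrite //= mem_iota.
  - by right; apply/imfsetP; exists i; rewrite //= mem_iota.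
case: ex_minnP => v nSv minv; apply/eqP; rewrite eqn_leq andbC minv/=; last first.
  apply/inS => -[i ltin [e|/a_eq_b e]]; last by rewrite e ltnn in ltin.
  by have := a_lt i n; rewrite e ltnn ltin.
rewrite leqNgt; apply: contra nSv => ltva; apply/inS.
have [->|/a_b_cover[i i_gt0 ei]] := posnP v; first by exists 0%N => //; left.
exists i; last by case: ei => <-; [left|right].
rewrite -a_lt; apply: leq_ltn_trans ltva.
by case: ei => <- //; apply: a_le_b.
Qed.

End GoldenRatio.

(** * Moves from and to the pairs *)

Section PPositions.
Variable R : realType.

Lemma move_ab (p q : position) (i j : nat) :
  move p q -> p = pos (a_ R i) (b_ R i) -> q <> pos (a_ R j) (b_ R j).
Proof.
have [ai aj] := (a_le_b R i, a_le_b R j).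
case=> x y k; last first.
  (* A diagonal move preserves the difference, which determines a positive index; index 0 is
     excluded since both piles stay positive. *)
  move=> /andP[x1 xy] /andP[k1 kx] _ /(congr1 val)/= [e1 e2] /(congr1 val)/= [e3 e4].
  case: i j ai aj e1 e2 e3 e4 => [|i] [|j] ai aj; rewrite ?b_S /=; try lia.
  move=> e1 e2 e3 e4; have ij : i = j by lia.
  by subst j; lia.
move=> /andP[k1 kx] /(congr1 val)/= [e1 e2] /(congr1 val)/= [e3 e4].
(* The untouched pile [y] is an entry of both pairs, and an entry determines its index. *)
have yi : y = a_ R i \/ y = b_ R i by lia.
have yj : y = a_ R j \/ y = b_ R j by lia.
suff ij : i = j by subst j; lia.
case: yi yj => [->|->] [].
- exact: (incn_inj (a_le R)).
- exact: a_eq_b.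
- by move/esym/a_eq_b.
- exact: (incn_inj (b_le R)).
Qed.

Lemma move_to_ab (p : position) :
    ~ (exists i, p = pos (a_ R i) (b_ R i)) ->
  exists2 q, move p q & exists i, q = pos (a_ R i) (b_ R i).
Proof.
rewrite (posE p); case: p => -[x y] /= xy nK.
have [x0|x_gt0] := posnP x.
  subst x; exists (pos 0 0); last by exists 0.
  rewrite posC -(subnn y); apply: move_one; rewrite leqnn andbT lt0n.
  by apply/eqP => y0; apply: nK; exists 0; rewrite y0.
have [i i_gt0 [e|e]] := a_b_cover R x_gt0; have ab := a_le_b R i.
- have [yb|by_|yb] := ltngtP y (b_ R i).
  + (* The pair with the same difference as [(x, y)] has a smaller index, and
       both ratios have integer part 1. *)
    have bE := b_lt_double_a R i_gt0; pose m := (y - x).+1.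
    have mi : m < i by move: yb; rewrite b_addE e /m; lia.
    have am : a_ R m < a_ R i by rewrite a_lt.
    have am0 : 0 < a_ R m by rewrite /m /a_ addn1.
    have bm : b_ R m = a_ R m + (y - x) by rewrite b_S.
    have bmE := @b_lt_double_a R m isT.
    exists (pos (a_ R m) (b_ R m)); last by exists m.
    have -> : a_ R m = x - (x - a_ R m) by lia.
    have -> : b_ R m = y - (x - a_ R m) by lia.
    by apply: move_both; [lia | lia | rewrite !divn_eq1//; lia].
  + exists (pos (a_ R i) (b_ R i)); last by exists i.
    rewrite posC [pos (a_ R i) _]posC -e -{1}(subKn (ltnW by_)).
    by apply: move_one; lia.
  + by case: nK; exists i; rewrite e yb.
(* Now [x = b_ i], so [y] is lowered to [a_ i]; equality [y = a_ i] would make the position the pair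
   itself. *)
have yx : a_ R i < y.
  rewrite ltn_neqAle; apply/andP; split; last by lia.
  by apply/eqP => ya; apply: nK; exists i; congr pos; lia.
exists (pos (a_ R i) (b_ R i)); last by exists i.
rewrite posC -e -{1}(subKn (ltnW yx)).
by apply: move_one; lia.
Qed.

End PPositions.

Theorem corollary6 (R : realType) :
  [set p : position | P_position p]%classic
    = range (fun i : nat => pos (a_ R i) (b_ R i)) /\
  forall n : nat, 1 <= n ->
    a_ R n = mex ([fset a_ R i | i in iota 0 n] `|` [fset b_ R i | i in iota 0 n])%fset /\
    b_ R n = a_ R n + n - 1.
Proof.
split; last first.
  move=> n n_gt0; split; first exact: a_mex.
  by rewrite b_addE; lia.
rewrite predeqE => p /=.
rewrite (@P_position_kernel (fun p => exists i, p = pos (a_ R i) (b_ R i))).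
- by split=> [[i ->]|[i _ <-]]; exists i.
- by move=> x y [i xE] xy [j]; apply: move_ab xy xE.
- exact: move_to_ab.
Qed.
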